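(* For every integer $n\ge 1$ there is a quantum circuit that maps $|x\rangle|0\rangle\mapsto|x\rangle|x^2\rangle$ for every integer $0\le x<2^n$, where $x$ is held in an $n$-qubit register and the output register has $2n$ qubits, built from Clifford gates together with additions/subtractions of two $w$-qubit numbers modulo $2^w$ (of various widths $w$), whose Toffoli count is $$T(n)=n+\sum_{i=0}^{n-2}(n-i)=\tfrac12 n(n+3)-1 .$$
   Context: Cost model: Clifford gates (in particular $X$, CNOT) cost no Toffoli gates. For each $w\ge1$, an in-place adder or subtractor $|a\rangle|b\rangle\mapsto|a\rangle|(b\pm a)\bmod 2^w\rangle$ of two $w$-qubit numbers costs $w-1$ Toffoli gates (Gidney's adder). Registers are in binary with $x=\sum_{i=0}^{n-1}x_i2^i$, $x_i\in\{0,1\}$. Registers may be padded with clean ancilla qubits in state $|0\rangle$, which must be returned to $|0\rangle$. The Toffoli count of a circuit is the sum of the costs of the adders/subtractors it uses. *)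

(* Defs.v *)
From HB Require Import structures.
From mathcomp Require Import all_boot all_order all_algebra.
From mathcomp Require Import reals complex.

Set Implicit Arguments.
Unset Strict Implicit.
Unset Printing Implicit Defensive.

Import Order.TTheory GRing.Theory Num.Theory.

(* Computational basis states of N qubits, and vectors of the Hilbert space
   C^(2^N), given by their amplitudes in that basis; C = R[i]. *)
Notation basis N := {ffun 'I_N -> bool}.
Notation qstate R N := {ffun basis N -> R[i]}.

Definition ket (R : realType) (N : nat) (s : basis N) : qstate R N :=
  [ffun y => ((y == s)%:R)%R].

Definition bit (v i : nat) : bool := odd (v %/ 2 ^ i).

(* A register is a tuple of wires, least significant first. *)
Definition reg_val (N w : nat) (r : w.-tuple 'I_N) (s : basis N) : nat :=
  \sum_(i < w) s (tnth r i) * 2 ^ i.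

Definition set_reg (N w : nat) (r : w.-tuple 'I_N) (v : nat) (s : basis N) :
    basis N :=
  [ffun q => if q \in r then bit v (index q r) else s q].

Definition flip (N : nat) (q : 'I_N) (s : basis N) : basis N :=
  [ffun p => if p == q then ~~ s p else s p].

(* H, S and CNOT generate the Clifford group (up to global phase), so the
   Clifford gates are represented by these generators; X = HSSH is included
   for convenience.  [Add a b] and [Sub a b] act in place on b. *)
Inductive gate (N : nat) : Type :=
| HGate of 'I_N
| SGate of 'I_N
| XGate of 'I_N
| CNOT (control target : 'I_N)
| Add (w : nat) (a b : w.-tuple 'I_N)
| Sub (w : nat) (a b : w.-tuple 'I_N).

Definition gate_wf (N : nat) (g : gate N) : bool :=
  match g with
  | HGate _ | SGate _ | XGate _ => true
  | CNOT c t => c != t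
  | Add w a b | Sub w a b => (0 < w) && uniq (a ++ b)
  end.

Definition toffoli_cost (N : nat) (g : gate N) : nat :=
  match g with
  | HGate _ | SGate _ | XGate _ | CNOT _ _ => 0
  | Add w _ _ | Sub w _ _ => w.-1
  end.

Definition add_basis (N w : nat) (a b : w.-tuple 'I_N) (s : basis N) :
    basis N :=
  set_reg b ((reg_val b s + reg_val a s) %% 2 ^ w) s.

(* reg_val a s < 2 ^ w, so the truncated subtraction is exact. *)
Definition sub_basis (N w : nat) (a b : w.-tuple 'I_N) (s : basis N) :
    basis N :=
  set_reg b ((reg_val b s + (2 ^ w - reg_val a s)) %% 2 ^ w) s.

(* The matrix entry <y| g |x>. *)
Definition gate_mx (R : realType) (N : nat) (g : gate N) (y x : basis N) :
    R[i] :=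
  (match g with
   | HGate q =>
       if [forall p, (p != q) ==> (y p == x p)]
       then (-1) ^+ (x q && y q) / sqrtC 2
       else 0
   | SGate q => if y == x then (if x q then 'i else 1) else 0
   | XGate q => (y == flip q x)%:R
   | CNOT c t => (y == if x c then flip t x else x)%:R
   | Add w a b => (y == add_basis a b x)%:R
   | Sub w a b => (y == sub_basis a b x)%:R
   end)%R.

Definition apply_gate (R : realType) (N : nat) (psi : qstate R N)
    (g : gate N) : qstate R N :=
  [ffun y => (\sum_(x : basis N) gate_mx R g y x * psi x)%R].

(* Gates are listed in order of application. *)
Definition circuit (N : nat) := seq (gate N).

Definition circuit_wf (N : nat) (c : circuit N) : bool := all (@gate_wf N) c.

Definition run (R : realType) (N : nat) (c : circuit N) (psi : qstate R N) :
    qstate R N :=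
  foldl (@apply_gate R N) psi c.

Definition toffoli_count (N : nat) (c : circuit N) : nat :=
  \sum_(g <- c) toffoli_cost g.

(* |x>|z>|0...0> with x on wires 0..n-1, z on wires n..3n-1 (both least
   significant bit first), and m ancilla qubits. *)
Definition registers (n m x z : nat) : basis (n + 2 * n + m) :=
  [ffun q : 'I_(n + 2 * n + m) =>
     if q < n then bit x q
     else if q < n + 2 * n then bit z (q - n)
     else false].

(* Main.v *)
(** Let X_i = x >> (i+1), of n-i-1 bits, and let c_i be X_i + 1 if x_i = 1 and
    2^(n-i-1) - X_i if x_i = 0. Then
      x^2 + 4^n = sum_(i<n) 2 * 4^i * c_i + (2^n x + 2^n - x).
    Xoring x_i into the higher bits of x by CNOTs and appending a constant 1 on
    top gives an (n-i)-bit number r with 2^(n-i) - r = c_i, so one subtraction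
    of r at offset 2i+1 of the output adds 2 * 4^i * c_i: the complement and
    its carry-in come for free. The partial sum stays below 2^(n+i+1), so a
    window of n-i qubits suffices, at cost n-i-1. One final subtraction on all
    2n output qubits, of the number with low half x and high half ~x, adds
    2^n x + 2^n - x modulo 4^n at cost 2n-1. *)

Require Import Defs.
From mathcomp Require Import all_boot all_order all_algebra.
From mathcomp Require Import reals complex.
From mathcomp Require Import zify ring lra.

Set Implicit Arguments.
Unset Strict Implicit.
Unset Printing Implicit Defensive.

Import GRing.Theory.

(** * Classical circuits acting on basis states *)

Definition classical N (g : gate N) : bool :=
  match g with HGate _ | SGate _ => false | _ => true end.

(** Meaningful for [classical] gates only; the H and S branch is a default value. *)
Definition step N (s : basis N) (g : gate N) : basis N :=
  match g with
  | HGate _ | SGate _ => s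
  | XGate q => flip q s
  | CNOT c t => if s c then flip t s else s
  | Add w a b => add_basis a b s
  | Defs.Sub w a b => sub_basis a b s
  end.

Definition exec N (c : circuit N) (s : basis N) : basis N :=
  foldl (@step N) s c.

Lemma exec_cat N (c d : circuit N) s : exec (c ++ d) s = exec d (exec c s).
Proof. exact: foldl_cat. Qed.

Lemma exec_cons N g (c : circuit N) s : exec (g :: c) s = exec c (step s g).
Proof. by []. Qed.

(** Against [ket R s] the sum over inputs reduces to column [s] of the matrix, which for a classical
    gate is the indicator of [step s g]. *)
Lemma apply_gate_ket (R : realType) N (g : gate N) (s : basis N) :
  classical g -> apply_gate (ket R s) g = ket R (step s g).
Proof.
move=> cg; apply/ffunP => y; rewrite !ffunE (bigD1 s) //= big1 => [|x xs].
  by rewrite ffunE eqxx mulr1 addr0; case: g cg.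
by rewrite ffunE (negPf xs) mulr0.
Qed.

Lemma run_ket (R : realType) N (c : circuit N) (s : basis N) :
  all (@classical N) c -> run c (ket R s) = ket R (exec c s).
Proof.
elim: c s => //= g c IH s /andP[cg cc].
by rewrite /run /= apply_gate_ket // -IH.
Qed.

Lemma toffoli_count_cat N (c d : circuit N) :
  toffoli_count (c ++ d) = toffoli_count c + toffoli_count d.
Proof. exact: big_cat. Qed.

Lemma all_flatten T (P : pred T) ss : all P (flatten ss) = all (all P) ss.
Proof. by elim: ss => //= s ss IH; rewrite all_cat IH. Qed.

(** * Binary expansions *)

Lemma bitDl v p q k : v < 2 ^ p ->
  bit (v + 2 ^ p * q) k = if k < p then bit v k else bit q (k - p).
Proof.
move=> vp; rewrite /bit; case: ltnP => kp.
  have -> : 2 ^ p * q = (2 ^ (p - k.+1) * q).*2 * 2 ^ k.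
    rewrite -{1}(subnK kp) expnD expnS -mul2n; ring.
  by rewrite addnC divnMDl ?expn_gt0 // oddD odd_double.
rewrite -{1}(subnKC kp) expnD divnMA addnC mulnC divnMDl ?expn_gt0 //.
by rewrite (divn_small vp) addn0.
Qed.

Lemma sum_bit v w : \sum_(j < w) bit v j * 2 ^ j = v %% 2 ^ w.
Proof.
elim: w => [|w IH]; first by rewrite big_ord0 modn1.
rewrite big_ord_recr /= IH /bit -modn2.
have Ev := divn_eq v (2 ^ w); set q := v %/ _ in Ev *.
have Eq := divn_eq q 2; rewrite {2}Ev {2}Eq.
have rP : v %% 2 ^ w < 2 ^ w by rewrite ltn_pmod ?expn_gt0.
have q2 : q %% 2 < 2 by rewrite ltn_mod.
rewrite expnS mulnDl -mulnA -addnA modnMDl [RHS]modn_small 1?addnC //.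
by move: rP q2; move: (2 ^ w) (q %% 2) (v %% _) => P b r; nia.
Qed.

Lemma sum_pow2 w : \sum_(j < w) 2 ^ j = 2 ^ w - 1.
Proof. by rewrite subn1 predn_exp mul1n. Qed.

(** Subtracting [v] from the all-ones number [2 ^ w - 1] flips each bit without borrowing. *)
Lemma sum_bitC v w : v < 2 ^ w ->
  \sum_(j < w) ~~ bit v j * 2 ^ j = 2 ^ w - 1 - v.
Proof.
move=> vw; rewrite -{2}(modn_small vw) -sum_bit -sum_pow2.
rewrite -[in RHS](eq_bigr _ (fun j _ => mul1n _)).
rewrite -sumnB => [|j _]; last by rewrite leq_mul2r leq_b1 orbT.
by apply: eq_bigr => j _; rewrite -mulnBl; case: bit.
Qed.

(** * Wires, registers and windows of the output *)

Section Layout.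

Variable n : nat.

Let N := n + 2 * n + n.+1.

(* Out-of-range numbers are sent to a default wire. *)
Definition wire (k : nat) : 'I_N := insubd (rshift (n + 2 * n) ord0) k.

Lemma wireK k : k < N -> wire k = k :> nat.
Proof. by move=> kN; rewrite val_insubd kN. Qed.

(* [v] and [a] give the bits of the input and ancilla wires, [z] is the value
   of the output register. *)
Definition layout (v : nat -> bool) (z : nat) (a : nat -> bool) : basis N :=
  [ffun q : 'I_N => if q < n then v q
                    else if q < n + 2 * n then bit z (q - n)
                    else a (q - (n + 2 * n))].

Lemma registers_layout x z :
  registers n n.+1 x z = layout (bit x) z (fun=> false).
Proof. by apply/ffunP => q; rewrite !ffunE. Qed.

Lemma eq_layout v v' z a a' :
  (forall k, k < n -> v k = v' k) -> (forall k, k <= n -> a k = a' k) ->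
  layout v z a = layout v' z a'.
Proof.
move=> Ev Ea; apply/ffunP => q; rewrite !ffunE.
case: ifP => [/Ev //|_]; case: ifP => // qn; apply: Ea.
by have : q < n + 2 * n + n.+1 := ltn_ord q; lia.
Qed.

Lemma layout_input v z a k : k < n -> layout v z a (wire k) = v k.
Proof. by move=> kn; rewrite ffunE wireK ?kn // /N; lia. Qed.

Lemma layout_output v z a k :
  k < 2 * n -> layout v z a (wire (n + k)) = bit z k.
Proof.
move=> kn; have kN : n + k < N by rewrite /N; lia.
by rewrite ffunE wireK // ltnNge leq_addr /= ltn_add2l kn addKn.
Qed.

Lemma layout_ancilla v z a k :
  k <= n -> layout v z a (wire (n + 2 * n + k)) = a k.
Proof.
move=> kn; have kN : n + 2 * n + k < N by rewrite /N; lia.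
rewrite ffunE wireK // addKn ltnNge -addnA leq_addr /=.
by rewrite ltnNge addnA leq_addr.
Qed.

Lemma flip_input v z a k : k < n ->
  flip (wire k) (layout v z a) = layout (fun q => v q (+) (q == k)) z a.
Proof.
move=> kn; have kN : k < N by rewrite /N; lia.
apply/ffunP => q; rewrite !ffunE -val_eqE /= wireK //.
case: (eqVneq (q : nat) k) => [->|_]; first by rewrite kn addbT.
by rewrite addbF.
Qed.

Lemma flip_ancilla v z a k : k <= n ->
  flip (wire (n + 2 * n + k)) (layout v z a) =
  layout v z (fun q => a q (+) (q == k)).
Proof.
move=> kn; have kN : n + 2 * n + k < N by rewrite /N; lia.
apply/ffunP => q; rewrite !ffunE -val_eqE /= wireK //.
case: (ltnP q n) => [qn|qn]; first by case: eqP => //; lia.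
case: (ltnP q (n + 2 * n)) => [q3|q3]; first by case: eqP => //; lia.
rewrite -[q - _ == k](eqn_add2l (n + 2 * n)) subnKC //.
by case: eqP => _; rewrite ?addbT ?addbF.
Qed.

Definition wires (f : nat -> nat) (w : nat) : w.-tuple 'I_N :=
  [tuple wire (f j) | j < w].

Lemma wiresP f w q : reflect (exists2 j, j < w & q = wire (f j)) (q \in wires f w).
Proof.
apply: (iffP (tnthP (wires f w) q)) => [[j ->]|[j jw ->]].
  by exists j => //; rewrite tnth_mktuple.
by exists (Ordinal jw); rewrite tnth_mktuple.
Qed.

Lemma uniq_wires f w :
  (forall j, j < w -> f j < N) -> {in gtn w &, injective f} ->
  uniq (wires f w).
Proof.
move=> fN fI; rewrite map_inj_uniq ?enum_uniq // => i j /(congr1 val) /=.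
by rewrite !wireK ?fN // => E; apply: val_inj; apply: fI; rewrite ?inE ?ltn_ord.
Qed.

Lemma uniq_wires_cat f g w :
  (forall j, j < w -> f j < N) -> {in gtn w &, injective f} ->
  (forall j, j < w -> g j < N) -> {in gtn w &, injective g} ->
  (forall i j, i < w -> j < w -> f i != g j) ->
  uniq (wires f w ++ wires g w).
Proof.
move=> fN fI gN gI fg; rewrite cat_uniq !uniq_wires //= andbT.
apply/hasPn => q /wiresP[j jw ->]; apply/negP => /wiresP[i iw].
move/(congr1 val) => /=; rewrite !wireK ?fN ?gN // => /esym/eqP.
by rewrite (negPf (fg _ _ iw jw)).
Qed.

Lemma reg_val_wires f w s :
  reg_val (wires f w) s = \sum_(j < w) s (wire (f j)) * 2 ^ j.
Proof. by apply: eq_bigr => j _; rewrite tnth_mktuple. Qed.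

Definition window p w := wires (fun j => n + (p + j)) w.

Lemma reg_val_window p w v z a : p + w <= 2 * n ->
  reg_val (window p w) (layout v z a) = (z %/ 2 ^ p) %% 2 ^ w.
Proof.
move=> pw; rewrite reg_val_wires -sum_bit; apply: eq_bigr => j _.
rewrite layout_output; last by have := ltn_ord j; lia.
by rewrite /bit expnD divnMA.
Qed.

(** The bound on [z] makes the output zero above the window, so the result consists of the low [p]
    bits and [u] alone. *)
Lemma set_reg_window p w v z a u : p + w <= 2 * n -> z < 2 ^ (p + w) ->
  u < 2 ^ w ->
  set_reg (window p w) u (layout v z a) =
  layout v (z %% 2 ^ p + 2 ^ p * u) a.
Proof.
move=> pw zb ub; apply/ffunP => q; rewrite ffunE.
have U : uniq (window p w).
  by apply: uniq_wires => [j|i j _ _]; rewrite /N; lia.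
have zp : z %% 2 ^ p < 2 ^ p by rewrite ltn_pmod ?expn_gt0.
case: (tnthP (window p w) q) => [[j ->]|qF].
  have jw := ltn_ord j.
  rewrite (tnth_nth (wire 0)) index_uniq ?size_tuple // -tnth_nth.
  rewrite tnth_mktuple layout_output; last by lia.
  by rewrite bitDl // ltnNge leq_addr /= addKn.
rewrite !ffunE; case: ifP => // qn; case: ifP => // qn3.
set k := q - n; rewrite bitDl //.
have [kp|kp] := ltnP k p.
  by rewrite {1}(divn_eq z (2 ^ p)) addnC mulnC bitDl // kp.
have kw : w <= k - p.
  rewrite leqNgt; apply/negP => kw; apply: qF; exists (Ordinal kw).
  rewrite /k in kp; apply/val_inj; rewrite tnth_mktuple /= /k.
  have <- : q = n + (p + (q - n - p)) :> nat by lia.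
  by rewrite wireK.
have small y e : y < 2 ^ e -> forall i, e <= i -> bit y i = false.
  move=> ye i ei; rewrite /bit divn_small //.
  by apply: leq_trans ye _; rewrite leq_exp2l.
by rewrite (small z (p + w)) ?(small u w) //; lia.
Qed.

(** The low [p] bits are untouched and the output is zero above the window, so subtracting in the
    window is subtracting modulo [2 ^ (p + w)] from the whole output value. *)
Lemma sub_window p w f v z a (s := layout v z a) :
  p + w <= 2 * n -> z < 2 ^ (p + w) ->
  sub_basis (wires f w) (window p w) s =
  layout v ((z + 2 ^ p * (2 ^ w - reg_val (wires f w) s)) %% 2 ^ (p + w)) a.
Proof.
move=> pw zb; rewrite /sub_basis reg_val_window // modnDml.
set r := _ - _; rewrite set_reg_window ?ltn_pmod ?expn_gt0 //.
congr layout; set q := z %/ _ + r; set t := z %% 2 ^ p.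
have tp : t < 2 ^ p by rewrite ltn_pmod ?expn_gt0.
have qw : q %% 2 ^ w < 2 ^ w by rewrite ltn_pmod ?expn_gt0.
(* The first summand is the carry out of the window, a multiple of the modulus. *)
have -> : z + 2 ^ p * r =
    q %/ 2 ^ w * 2 ^ (p + w) + (t + 2 ^ p * (q %% 2 ^ w)).
  rewrite {1}(divn_eq z (2 ^ p)) -/t expnD.
  have := divn_eq q (2 ^ w); rewrite {1}/q; nia.
by rewrite modnMDl [RHS]modn_small // expnD; nia.
Qed.

(** * CNOT fans and ancilla preparation *)

Definition copy_input (i : nat) (r : seq nat) : circuit N :=
  [seq CNOT (wire i) (wire j) | j <- r].

(** The control is not among the targets, so it keeps its value throughout and a second run undoes
    the first. *)
Lemma exec_copy_input i r v z a : i < n -> uniq r -> i \notin r ->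
  {in r, forall j, j < n} ->
  exec (copy_input i r) (layout v z a) =
  layout (fun q => v q (+) ((q \in r) && v i)) z a.
Proof.
move=> i_n; elim: r v => [|j r IH] v.
  by move=> *; apply: eq_layout => // k _; rewrite addbF.
rewrite /= inE negb_or => /andP[jr r_uniq] /andP[ij ir] rn.
have jn : j < n by apply: rn; rewrite mem_head.
rewrite layout_input // flip_input //.
have -> : (if v i then layout (fun q => v q (+) (q == j)) z a
           else layout v z a) =
          layout (fun q => v q (+) ((q == j) && v i)) z a.
  by case: (v i); apply: eq_layout => // k _; rewrite ?andbT ?andbF ?addbF.
rewrite -/(copy_input i r) -/(exec _ _) IH //; last first.
  by move=> k kr; apply: rn; rewrite inE kr orbT.
apply: eq_layout => // k _; rewrite inE (negPf ij) /= addbF -addbA.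
by case: eqP => [->|]; rewrite ?(negPf jr) ?addbF //= addFb.
Qed.

Definition prepare (r : seq nat) : circuit N :=
  flatten [seq [:: CNOT (wire j) (wire (n + 2 * n + j));
                   XGate (wire (n + 2 * n + j))] | j <- r].

Lemma exec_prepare r v z a : uniq r -> {in r, forall j, j < n} ->
  exec (prepare r) (layout v z a) =
  layout v z (fun q => a q (+) ((q \in r) && ~~ v q)).
Proof.
elim: r a => [|j r IH] a.
  by move=> *; apply: eq_layout => // k _; rewrite addbF.
rewrite /= => /andP[jr r_uniq] rn.
have jn : j < n by apply: rn; rewrite mem_head.
rewrite layout_input // flip_ancilla 1?ltnW //.
have -> : (if v j then layout v z (fun q => a q (+) (q == j))
           else layout v z a) =
          layout v z (fun q => a q (+) ((q == j) && v j)).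
  by case: (v j); apply: eq_layout => // k _; rewrite ?andbT ?andbF ?addbF.
rewrite flip_ancilla 1?ltnW // -/(prepare r) -/(exec _ _) IH //; last first.
  by move=> k kr; apply: rn; rewrite inE kr orbT.
apply: eq_layout => // k _; rewrite inE.
case: eqP => [->|_]; rewrite ?(negPf jr) /= ?addbF //.
by case: (v j); case: (a j).
Qed.

(** * One squaring step per input bit *)

(* Ancilla wire [n] holds the constant 1. *)
Definition addend (i k : nat) : nat :=
  if k < n - i.+1 then i.+1 + k else n + 2 * n + n.

(** The higher input bits serve in place as part of the subtrahend; the second [fan] restores
    them. *)
Definition square_step (i : nat) : circuit N :=
  let w := (n - i.+1).+1 in
  let fan := copy_input i (iota i.+1 (n - i.+1)) in
  fan ++ Defs.Sub (wires (addend i) w) (window (2 * i).+1 w) :: fan.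

(** This is [c_i] of the decomposition of [x ^ 2 + 4 ^ n]. *)
Definition partial_square (x i : nat) : nat :=
  if bit x i then (x %/ 2 ^ i.+1).+1 else 2 ^ (n - i.+1) - x %/ 2 ^ i.+1.

Lemma partial_square_le x i : i < n -> x < 2 ^ n ->
  partial_square x i <= 2 ^ (n - i.+1).
Proof.
move=> ni xn; rewrite /partial_square; case: ifP; rewrite ?leq_subr // => _.
by rewrite ltn_divLR ?expn_gt0 // -expnD subnK.
Qed.

(** With [m = n - i - 1] and [X = x / 2 ^ (i + 1)], the register reads [2 ^ m + (2 ^ m - 1 - X)] if
    bit [i] is set and [2 ^ m + X] otherwise; the leading [2 ^ m] is the constant ancilla. *)
Lemma reg_val_addend x z (a : nat -> bool) i : i < n -> x < 2 ^ n -> a n ->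
  2 ^ (n - i.+1).+1 - reg_val (wires (addend i) (n - i.+1).+1)
    (layout (fun q => bit x q (+)
              ((q \in iota i.+1 (n - i.+1)) && bit x i)) z a) =
  partial_square x i.
Proof.
move=> ni xn an; rewrite reg_val_wires big_ord_recr /= /addend ltnn.
rewrite layout_ancilla // an mul1n.
set X := x %/ 2 ^ i.+1; set m := n - i.+1.
have Xm : X < 2 ^ m by rewrite ltn_divLR ?expn_gt0 // -expnD subnK.
rewrite (eq_bigr (fun j : 'I_m => (bit X j (+) bit x i) * 2 ^ j)).
  rewrite /partial_square -/X -/m expnS; case: (bit x i).
    under eq_bigr => j _ do rewrite addbT.
    by rewrite sum_bitC //; lia.
  under eq_bigr => j _ do rewrite addbF.
  by rewrite sum_bit modn_small //; lia.
move=> j _; rewrite ltn_ord layout_input; last first.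
  by have := ltn_ord j; rewrite /m; lia.
rewrite mem_iota leq_addr ltn_add2l ltn_ord /=.
by rewrite /X /bit expnD divnMA.
Qed.

Lemma exec_square_step x z (a : nat -> bool) i : i < n -> x < 2 ^ n -> a n ->
  z < 2 ^ (n + i) ->
  exec (square_step i) (layout (bit x) z a) =
  layout (bit x) (z + 2 ^ (2 * i).+1 * partial_square x i) a.
Proof.
move=> ni xn an zb; set r := iota i.+1 (n - i.+1).
have ir : i \notin r by rewrite mem_iota ltnn.
have rn : {in r, forall j, j < n}.
  by move=> j; rewrite mem_iota; lia.
rewrite /square_step exec_cat exec_copy_input ?iota_uniq //=.
have E : (2 * i).+1 + (n - i.+1).+1 = n + i.+1 by lia.
rewrite sub_window; first last.
- by apply: leq_trans zb _; rewrite E leq_exp2l; lia.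
- by rewrite E; lia.
rewrite reg_val_addend // E modn_small; last first.
  (* The old value is below [2 ^ (n + i)] and the added term is at most that, so the window does not
     overflow. *)
  apply: (@leq_trans (2 ^ (n + i) + 2 ^ (n + i))); last first.
    by rewrite addnS expnS mul2n -addnn.
  rewrite -addSn leq_add // (leq_trans (leq_mul (leqnn _) (partial_square_le ni xn))) //.
  by rewrite -expnD leq_exp2l; lia.
rewrite -/(exec _ _) exec_copy_input ?iota_uniq //.
apply: eq_layout => // k _; rewrite (negPf ir) /= addbF -addbA.
by rewrite addbb addbF.
Qed.

(** * The final correction *)

(* Ancilla wires [0 .. n-1] hold the complement of the input. *)
Definition final_addend (k : nat) : nat :=
  if k < n then k else n + 2 * n + (k - n).

Definition correction : gate N :=
  Defs.Sub (wires final_addend (n + n)) (window 0 (n + n)).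

(** The subtrahend is [x + 2 ^ n * (2 ^ n - 1 - x)], whose complement to [4 ^ n] is
    [2 ^ n * x + 2 ^ n - x]. *)
Lemma step_correction x z (a : nat -> bool) : x < 2 ^ n -> z < 2 ^ (n + n) ->
  (forall k, k < n -> a k = ~~ bit x k) ->
  step (layout (bit x) z a) correction =
  layout (bit x) ((z + (2 ^ n * x + 2 ^ n - x)) %% 2 ^ (n + n)) a.
Proof.
move=> xn zn an; rewrite /= sub_window ?add0n //; last by rewrite addnn mul2n.
rewrite mul1n reg_val_wires big_split_ord /=.
rewrite (eq_bigr (fun j : 'I_n => bit x j * 2 ^ j)); last first.
  by move=> j _; rewrite /final_addend ltn_ord layout_input.
rewrite sum_bit (modn_small xn).
rewrite (eq_bigr (fun j : 'I_n => 2 ^ n * (~~ bit x j * 2 ^ j))).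
  rewrite -big_distrr sum_bitC //= expnD.
  by congr (layout _ ((_ + _) %% _) _); move: (2 ^ n) xn => P; nia.
move=> j _; rewrite /final_addend ltnNge leq_addr /= addKn.
by rewrite layout_ancilla ?an ?(ltnW (ltn_ord j)) // expnD mulnCA.
Qed.

(** * The full circuit *)

Definition prepare_all : circuit N :=
  XGate (wire (n + 2 * n + n)) :: prepare (iota 0 n).

Lemma exec_prepare_all v z a :
  exec prepare_all (layout v z a) =
  layout v z (fun q => a q (+) ((q == n) (+) ((q < n) && ~~ v q))).
Proof.
rewrite /prepare_all /= flip_ancilla // -/(exec _ _) exec_prepare ?iota_uniq //.
  by apply: eq_layout => // k _; rewrite mem_iota addbA.
by move=> k; rewrite mem_iota.
Qed.

(* [prepare_all] is an involution, so the second copy uncomputes the ancillas. *)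
Definition squarer : circuit N :=
  prepare_all ++ flatten [seq square_step i | i <- iota 0 n]
    ++ correction :: prepare_all.

(** The bound is proved along with the execution because the next step needs it to stay within its
    window. *)
Lemma exec_square_steps x (a : nat -> bool) k : k <= n -> x < 2 ^ n -> a n ->
  let z := \sum_(i < k) 2 ^ (2 * i).+1 * partial_square x i in
  z < 2 ^ (n + k) /\
  exec (flatten [seq square_step i | i <- iota 0 k]) (layout (bit x) 0 a) =
  layout (bit x) z a.
Proof.
move=> kn xn an /=; elim: k kn => [|k IH] kn.
  by rewrite big_ord0 expn_gt0.
have [zb E] := IH (ltnW kn); rewrite big_ord_recr.
split; last first.
  rewrite -[in iota _ _]addn1 iotaD map_cat flatten_cat exec_cat E /= cats0.
  by rewrite exec_square_step.
rewrite /=; apply: (@leq_trans (2 ^ (n + k) + 2 ^ (n + k))); last first.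
  by rewrite addnS expnS mul2n -addnn.
rewrite -addSn leq_add // (leq_trans (leq_mul (leqnn _) (partial_square_le kn xn))) //.
by rewrite -expnD leq_exp2l; lia.
Qed.

End Layout.

(** * The arithmetic identity *)

(** Induction on [n] removes the lowest bit of [x]: the terms with [i > 0] are four times those of
    [x./2], one index lower. *)
Lemma sum_partial_square n x : x < 2 ^ n ->
  \sum_(i < n) 2 ^ (2 * i).+1 * partial_square n x i + (2 ^ n * x + 2 ^ n - x)
  = x ^ 2 + 2 ^ (n + n).
Proof.
elim: n x => [|n IH] x xn; first by rewrite big_ord0; case: x xn.
have x2n : x./2 < 2 ^ n by rewrite -divn2 ltn_divLR // -expnSr.
have xE k : x %/ 2 ^ k.+1 = x./2 %/ 2 ^ k by rewrite expnS divnMA divn2.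
rewrite big_ord_recl.
rewrite (eq_bigr (fun i : 'I_n =>
  4 * (2 ^ (2 * i).+1 * partial_square n x./2 i))); last first.
  move=> i _; rewrite !lift0 /partial_square /bit subSS !xE.
  by rewrite mulnS !expnS; ring.
have := IH _ x2n; rewrite -big_distrr /=; set S := bigop _ _ _ => ES.
rewrite /partial_square /bit muln0 xE expn0 !divn1 expn1 subSS subn0.
have := odd_double_half x; move: ES x2n.
rewrite addSn addnS !expnS expnD expn0 !muln1.
move: (x./2) (2 ^ n) => y P ES yP.
(* Moving [y] across removes the truncated subtraction from the induction hypothesis. *)
have {}ES : S + P * y + P = y * y + P * P + y by nia.
by case: (odd x) => <-; rewrite -muln2; nia.
Qed.

(** * Toffoli count and well-formedness *)

Lemma toffoli_squarer n : 0 < n ->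
  toffoli_count (squarer n) = n + \sum_(0 <= i < n.-1) (n - i).
Proof.
have fan i r : toffoli_count (copy_input n i r) = 0.
  by rewrite /toffoli_count big_map big1.
have prep : toffoli_count (prepare_all n) = 0.
  rewrite /toffoli_count big_cons add0n big_flatten big_map big1 // => j _.
  by rewrite !big_cons big_nil.
have steps k : toffoli_count (flatten [seq square_step n i | i <- iota 0 k])
    = \sum_(0 <= i < k) (n - i.+1).
  rewrite /toffoli_count big_flatten big_map /index_iota subn0.
  apply: eq_bigr => i _; rewrite -/(toffoli_count _) toffoli_count_cat fan.
  by rewrite /toffoli_count big_cons -/(toffoli_count _) fan addn0.
move=> n0; rewrite /squarer !toffoli_count_cat steps prep.
rewrite /toffoli_count big_cons -/(toffoli_count _) prep /=.
case: n n0 {fan prep steps} => // n _ /=.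
(* Here the input has [n + 1] bits. The last step costs nothing; raising each of the other [n] terms
   by one uses up [n] of the correction's cost [2n + 1] and leaves [n + 1]. *)
rewrite big_nat_recr //= subnn.
suff : \sum_(0 <= i < n) (n.+1 - i) = \sum_(0 <= i < n) (n.+1 - i.+1) + n.
  by lia.
rewrite -[X in _ + X]subn0 -[X in _ + X]muln1 -sum_nat_const_nat -big_split /=.
by apply: eq_big_nat => i; lia.
Qed.

(** Doubling and the successor avoid the division and the subtraction of the closed form. *)
Lemma toffoli_squarer_closed n : 0 < n ->
  2 * (toffoli_count (squarer n)).+1 = n * (n + 3).
Proof.
move=> n0; rewrite toffoli_squarer //; case: n n0 => // n _ /=.
rewrite (@eq_big_nat _ _ _ 0 n _ (fun i => n.+1 - i)) //.
suff : 2 * \sum_(0 <= i < n) (n.+1 - i) = n * (n + 3) by nia.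
elim: n => [|n IH]; first by rewrite big_geq.
by rewrite big_nat_recl // subn0; under eq_bigr do rewrite subSS; nia.
Qed.

(** Each subtrahend lies on input and ancilla wires, while its window lies on output wires. *)
Lemma squarer_wf n : 0 < n -> circuit_wf (squarer n).
Proof.
move=> n0; have fan i r : i < n -> {in r, forall j, j < n} -> i \notin r ->
    circuit_wf (copy_input n i r).
  move=> ni rn ir; rewrite /circuit_wf all_map; apply/allP => j jr /=.
  rewrite -val_eqE /= !wireK; try by have := rn j jr; lia.
  by apply: contraNneq ir => ->.
have prep : circuit_wf (prepare_all n).
  rewrite /circuit_wf /= all_flatten all_map; apply/allP => j.
  by rewrite mem_iota /= -val_eqE /= => jn; rewrite !wireK; lia.
rewrite /circuit_wf !all_cat; apply/and3P; split=> //; last first.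
  apply/andP; split=> //; apply/andP; split; first by rewrite addn_gt0 n0.
  by apply: uniq_wires_cat => [j|i j|j|i j|i j]; rewrite /final_addend ?inE;
     do ?[case: ifP]; lia.
rewrite all_flatten all_map; apply/allP => i; rewrite mem_iota => ni.
have fani : circuit_wf (copy_input n i (iota i.+1 (n - i.+1))).
  by apply: fan => [|j|]; rewrite ?mem_iota; lia.
rewrite [preim _ _ _]all_cat; apply/and3P; split=> //.
apply: uniq_wires_cat => [j|k j|j|k j|k j]; rewrite /addend ?inE;
  do ?[case: ifP]; lia.
Qed.

(** * Correctness of the squarer *)

Lemma exec_squarer n x : x < 2 ^ n ->
  exec (squarer n) (registers n n.+1 x 0) = registers n n.+1 x (x ^ 2).
Proof.
move=> xn; rewrite !registers_layout /squarer !exec_cat exec_prepare_all.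
set a := fun q => false (+) _.
have an : a n by rewrite /a eqxx ltnn.
have [zb ->] := exec_square_steps (leqnn n) xn an.
rewrite exec_cons step_correction //; last first.
  by move=> k kn; rewrite /a kn ltn_eqF.
(* The excess [4 ^ n] vanishes modulo [4 ^ n], and [x ^ 2] is already reduced. *)
rewrite sum_partial_square // modnDr modn_small; last first.
  by rewrite addnn -muln2 expnM ltn_exp2r.
rewrite exec_prepare_all.
by apply: eq_layout => // k _; rewrite /a addFb addbb.
Qed.

Lemma classical_squarer n : all (@classical _) (squarer n).
Proof.
have fan i r : all (@classical _) (copy_input n i r).
  by rewrite all_map; apply/allP.
have prep : all (@classical _) (prepare_all n).
  by rewrite /= all_flatten all_map; apply/allP.
rewrite !all_cat; apply/and3P; split=> //; rewrite all_flatten all_map.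
by apply/allP => i _; rewrite [preim _ _ _]all_cat; apply/and3P; split.
Qed.

Theorem mainTheorem2 (R : realType) (n : nat) (hn : 1 <= n) :
  exists (m : nat) (c : circuit (n + 2 * n + m)),
    [/\ circuit_wf c,
        forall x : nat, x < 2 ^ n ->
          run c (ket R (registers n m x 0)) = ket R (registers n m x (x ^ 2)),
        toffoli_count c = n + \sum_(0 <= i < n.-1) (n - i)
      & ((toffoli_count c)%:R = 1 / 2 * n%:R * (n%:R + 3) - 1 :> rat)%R].
Proof.
(* There are [n] ancillas for the complement of [x] and one for the constant 1. *)
exists n.+1, (squarer n); split.
- exact: squarer_wf.
- by move=> x xn; rewrite run_ket ?classical_squarer // exec_squarer.
- exact: toffoli_squarer.
have := congr1 (fun k => k%:R : rat)%R (toffoli_squarer_closed hn).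
move: (toffoli_count _) => t.
by rewrite /= !natrM natrD -[in X in X -> _]natr1; lra.
Qed.
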